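(* Let $G$ be a finite group and let $p$ be a fixed prime divisor of $|G|$. Suppose that every maximal subgroup of $G$ is nilpotent, or normal in $G$, or has order not divisible by $p$. Then $G$ is solvable. *)

(* Defs.v *)
From mathcomp Require Import all_boot all_fingroup all_solvable.

(* Main.v *)
(** In a minimal counterexample G has a unique minimal normal subgroup N, G/N
is solvable and N is not, so no nontrivial normal subgroup of G is nilpotent.
A maximal subgroup M of order divisible by p that does not contain N is
therefore nilpotent, and M is the normalizer of its Sylow p-subgroup, which is
then a Sylow p-subgroup of G. Hence every proper supplement H of N whose order
is divisible by p lies in the normalizer of some Sylow p-subgroup of G.

If p divides |G : N|, take for H the normalizer of any Sylow r-subgroup of N
(Frattini). As the normalizers of the Sylow p-subgroups are all conjugate, a
single one of them meets N in a subgroup of order divisible by |N|, so it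
contains N: a contradiction.

If p does not divide |G : N|, then N contains every Sylow p-subgroup S of G,
and N_G(S) = S x K is nilpotent with G = NK. For 1 < Q <= S the normalizer of Q
contains K, so it is a supplement too and lies in the normalizer of a Sylow
p-subgroup. It follows that distinct Sylow p-subgroups of G intersect
trivially, so that S controls its own fusion; by transfer S is not contained in
G', which contradicts S <= N <= G'. *)

Require Import Defs.
From mathcomp Require Import all_boot all_fingroup ssralg all_solvable.

Set Implicit Arguments.
Unset Strict Implicit.

Local Open Scope group_scope.

(** * Transfer into a Sylow subgroup *)

Section FocalSubgroup.

Variable gT : finGroupType.
Implicit Types G P : {group gT}.

(* By the assumption on fusion, the transfer G -> P / P' maps x in P to the
   class of x ^+ #|G : P|, and it is trivial on G'. *)
Lemma der1_setI_Sylow (p : nat) G P :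
    p.-Sylow(G) P ->
    (forall x g, x \in P -> g \in G -> x ^ g \in P ->
       exists2 h, h \in P & x ^ g = x ^ h) ->
  P :&: G^`(1) \subset P^`(1).
Proof.
move=> sylP fusP; have [sPG pP p'iPG] := and3P sylP.
have nP'P : P \subset 'N(P^`(1)) := der_norm 1 P.
have abPP' : abelian (P / P^`(1)) by apply: sub_der1_abelian.
pose f := restrm_morphism nP'P (coset_morphism P^`(1)).
have abf : abelian (f @* P) by rewrite morphim_restrm setIid.
have Pf y : y \in P -> f y \in f @* P by move=> Py; apply: mem_morphim.
apply/subsetP=> x /setIP[Px G'x]; have Gx := subsetP sPG x Px.
have tau_x : transfer G abf x = (FiniteModule.fmod abf (f x) *+ #|G : P|)%R.
  have [X trX] : exists X, is_transversal X (rcosets P G :* <[x]>) G.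
    have partG := rcosets_cycle_partition sPG Gx.
    by exists (transversal (rcosets P G :* <[x]>) G); apply: transversalP.
  rewrite (transfer_cycle_expansion sPG abf Gx trX).
  rewrite -(sum_index_rcosets_cycle sPG Gx trX) -GRing.sumrMnr.
  (* The [x]-orbit of the coset [P :* y] has length [n] and contributes [(x ^+ n) ^ y^-1]. By fusion
     this is a [P]-conjugate of [x ^+ n], so both have the same image in the abelian group
     [f @* P]. *)
  apply: eq_bigr => y Xy; set n := #|_ : _|.
  have Gy : y \in G := subsetP (transversal_sub trX) y Xy.
  have Pxn : x ^+ n \in P by rewrite groupX.
  have Pxny : (x ^+ n) ^ y^-1 \in P.
    by rewrite conjgE invgK mulgA -mem_rcoset mulg_exp_card_rcosets.
  have [h Ph ->] := fusP _ _ Pxn (groupVr Gy) Pxny.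
  rewrite -FiniteModule.fmodX ?Pf // -(morphX f n Px).
  congr (FiniteModule.fmod abf _).
  rewrite /restrm /= -/(f _) -/(f (x ^+ n)) (morphJ f) //.
  by rewrite /conjg (centsP abf _ (Pf _ Pxn) _ (Pf _ Ph)) mulKg.
have G'tau : G^`(1) \subset 'ker (transfer_morphism G abf).
  rewrite gen_subG; apply/subsetP=> _ /imset2P[y z Gy Gz ->].
  apply/kerP; first exact: groupR.
  rewrite morphR //. apply/eqP/commgP; exact: GRing.addrC.
have := mker (subsetP G'tau x G'x); rewrite /= tau_x.
rewrite -FiniteModule.fmodX ?Pf //.
move/(congr1 (@FiniteModule.fmval _ _ abf)).
rewrite FiniteModule.fmodK ?groupX ?Pf // FiniteModule.fmval0 => fx1.
(* The order of [f x] is a power of [p] and divides [#|G : P|], which is prime to [p]. *)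
have pfx : p.-elt (f x) by apply: morph_p_elt => //; apply: mem_p_elt pP Px.
apply: coset_idr (subsetP nP'P x Px) _; apply/eqP.
rewrite -[coset _ x]/(f x) -order_eq1.
by apply/eqP/(pnat_1 pfx)/(pnat_dvd _ p'iPG); rewrite order_dvdn fx1.
Qed.

End FocalSubgroup.

(** * Supplements and intersections of Sylow subgroups *)

Section Supplements.

Variables (gT : finGroupType) (p : nat) (G : {group gT}).
Hypothesis Gp1 : 'O_p(G) = 1.
Implicit Types H M N P Q S : {group gT}.

Lemma pgroup_norm_proper Q :
  Q \subset G -> p.-group Q -> Q :!=: 1 -> 'N_G(Q) \proper G.
Proof.
move=> sQG pQ; rewrite properEneq subsetIl andbT.
apply: contra => /eqP/setIidPl.
by move=> nQG; rewrite -subG1 -Gp1 pcore_max // /normal sQG.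
Qed.

(** Maximality forces [M] to be the normalizer of ['O_p(M)]. If [T] is a Sylow subgroup of [G] above
    ['O_p(M)], then ['N_T('O_p(M))] is a [p]-subgroup of [M], so it lies in ['O_p(M)]; as
    normalizers grow in [T], this gives [T = 'O_p(M)]. *)
Lemma nilpotent_maximal_norm_Sylow M :
    prime p -> maximal M G -> nilpotent M -> p %| #|M| ->
  exists2 S : {group gT}, p.-Sylow(G) S & M :=: 'N_G(S).
Proof.
move=> p_pr maxM nilM pM; have sMG := maxgroupp maxM.
have sylS : p.-Sylow(M) 'O_p(M) := nilpotent_pcore_Hall p nilM.
have ntS : 'O_p(M) != 1.
  by rewrite -cardG_gt1 (card_Hall sylS) p_part_gt1 mem_primes p_pr cardG_gt0.
have sSG : 'O_p(M) \subset G := subset_trans (pcore_sub p M) (proper_sub sMG).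
have prN := pgroup_norm_proper sSG (pcore_pgroup p M) ntS.
have defM : M :=: 'N_G('O_p(M)).
  case/maxgroupP: maxM => _ maxM; apply/esym/maxM => //.
  by rewrite subsetI proper_sub // gFnorm.
exists 'O_p(M)%G => //=.
have [T sylT sST] := Sylow_superset sSG (pcore_pgroup p M).
have [sTG pT _] := and3P sylT.
suff -> : 'O_p(M) = T by [].
apply/esym/(nilpotent_sub_norm (pgroup_nil pT) sST).
have pNT : p.-group 'N_T('O_p(M)) := pgroupS (subsetIl _ _) pT.
rewrite (sub_normal_Hall sylS) ?pcore_normal //.
by rewrite (subset_trans (setSI _ sTG)) // -defM.
Qed.

Lemma supplement_sub_norm_Sylow N H :
    prime p ->
    (forall M, maximal M G -> p %| #|M| -> ~~ (N \subset M) -> nilpotent M) ->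
    H \proper G -> p %| #|H| -> N * H = G ->
  exists S, [/\ p.-Sylow(G) S, H \subset 'N(S), nilpotent 'N_G(S)
              & ~~ (N \subset 'N(S))].
Proof.
move=> p_pr nilmax prH pH defG; have sHG := proper_sub prH.
have sNG : N \subset G by rewrite -defG mulG_subl.
have [eqH | [M maxM sHM]] := maximal_exists sHG.
  by rewrite eqH properxx in prH.
have nNM : ~~ (N \subset M).
  apply: contraL (maxgroupp maxM) => sNM.
  have sGM : G \subset M by rewrite -defG mul_subG.
  by rewrite properE sGM andbF.
have pM : p %| #|M| := dvdn_trans pH (cardSg sHM).
have nilM := nilmax M maxM pM nNM.
have [S sylS defM] := nilpotent_maximal_norm_Sylow p_pr maxM nilM pM.
exists S; rewrite -defM; split=> //.
  by rewrite (subset_trans sHM) // defM subsetIr.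
by apply: contra nNM; rewrite defM subsetI sNG.
Qed.

End Supplements.

(** Induction upwards on [Q]. If [Q] is proper in a Sylow subgroup [V], then ['N_V(Q)] is larger
    than [Q] and, normalizing [U], lies in [U]; by induction [V = U], where [U] depends on [Q]
    only. *)
Lemma Sylow_TI (gT : finGroupType) (p : nat) (G : {group gT}) :
    (forall Q : {group gT}, Q \subset G -> p.-group Q -> Q :!=: 1 ->
       exists2 S : {group gT}, p.-Sylow(G) S & 'N_G(Q) \subset 'N(S)) ->
  forall Q S T : {group gT}, Q :!=: 1 -> p.-Sylow(G) S -> p.-Sylow(G) T ->
  Q \subset S -> Q \subset T -> S :=: T.
Proof.
move=> locG Q S T; have [n] := ubnP (#|G| - #|Q|).
elim: n Q S T => // n IHn Q S T leQn ntQ sylS sylT sQS sQT.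
have [sSG pS _] := and3P sylS.
have sQG := subset_trans sQS sSG; have pQ := pgroupS sQS pS.
have [U sylU nUQ] := locG Q sQG pQ ntQ; have [sUG pU _] := and3P sylU.
have toU (V : {group gT}) : p.-Sylow(G) V -> Q \proper V -> V :=: U.
  move=> sylV ltQV; have [sVG pV _] := and3P sylV.
  have ltQN := nilpotent_proper_norm (pgroup_nil pV) ltQV.
  have sNV := subsetIl V 'N(Q).
  have sNU : 'N_V(Q) \subset U.
    have sylU' : p.-Sylow('N_G(U)) U.
      by rewrite (pHall_subl _ _ sylU) ?subsetIl // subsetI sUG normG.
    rewrite (sub_normal_Hall sylU') ?(pgroupS sNV) //.
      by rewrite normalSG.
    rewrite subsetI (subset_trans sNV) //=.
    by rewrite (subset_trans _ nUQ) // setSI.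
  apply: (IHn 'N_V(Q)%G) => //=.
    have leNG : #|'N_V(Q)| <= #|G| := subset_leq_card (subset_trans sNV sVG).
    have ltQN' := proper_card ltQN.
    rewrite -ltnS; apply: leq_trans leQn.
    by rewrite ltnS ltn_sub2l // (leq_trans ltQN').
  by rewrite -proper1G (sub_proper_trans (sub1G Q)).
have [eqQS | ltQS] := eqVproper sQS.
  apply/eqP; rewrite eqEcard -{1}eqQS sQT.
  by rewrite (card_Hall sylS) (card_Hall sylT) /=.
have [eqQT | ltQT] := eqVproper sQT.
  apply/eqP; rewrite eq_sym eqEcard -{1}eqQT sQS.
  by rewrite (card_Hall sylS) (card_Hall sylT) /=.
by rewrite (toU S) // (toU T).
Qed.

(** * The two cases for the index of [N] *)

Section NormalSubgroup.

Variables (gT : finGroupType) (p : nat) (G N : {group gT}).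
Hypotheses (p_pr : prime p) (nsNG : N <| G).
Hypothesis nilmax : forall M : {group gT},
  maximal M G -> p %| #|M| -> ~~ (N \subset M) -> nilpotent M.
Implicit Types P Q S : {group gT}.

Lemma dvdn_index_nilpotent_maximal :
  (forall r : nat, 'O_r(G) = 1) -> p %| #|G : N| -> N :=: 1.
Proof.
move=> Gr1 piGN; apply/eqP/idPn => ntN; have [sNG nNG] := andP nsNG.
have locN r (R : {group gT}) : r \in \pi(N) -> r.-Sylow(N) R ->
    exists S, [/\ p.-Sylow(G) S, R \subset 'N(S) & ~~ (N \subset 'N(S))].
  move=> rN sylR; have [sRN rR _] := and3P sylR.
  have ntR : R :!=: 1 by rewrite -cardG_gt1 (card_Hall sylR) p_part_gt1.
  have sRG := subset_trans sRN sNG.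
  have defG := Frattini_arg nsNG sylR.
  have pH : p %| #|'N_G(R)|.
    apply: dvdn_trans piGN _.
    by rewrite -card_quotient // -{1}defG quotientMidl dvdn_quotient.
  have prH := pgroup_norm_proper (Gr1 r) sRG rR ntR.
  have [S [sylS sHS _ nNS]] :=
    supplement_sub_norm_Sylow (Gr1 p) p_pr nilmax prH pH defG.
  by exists S; split=> //; apply: subset_trans sHS; rewrite subsetI sRG normG.
have rN : pdiv #|N| \in \pi(N) by rewrite pi_pdiv cardG_gt1.
have [R0 sylR0] := Sylow_exists (pdiv #|N|) N.
have [S0 [sylS0 _ /negP[]]] := locN _ _ rN sylR0.
apply/setIidPl/eqP; rewrite eqEcard subsetIl dvdn_leq ?cardG_gt0 //.
(* One prime at a time: [S] depends on [r], but it is conjugate to [S0] under some [x] that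
   normalizes [N], so [N :&: 'N(S)] and [N :&: 'N(S0)] have the same order. *)
apply/dvdn_partP=> // r {}rN; have [R sylR] := Sylow_exists r N.
have [S [sylS sRS _]] := locN r R rN sylR.
have [x Gx ->] := Sylow_trans sylS sylS0.
rewrite normJ -{2}(normsP nNG x Gx) -conjIg cardJg.
by rewrite -(card_Hall sylR) cardSg // subsetI sRS (pHall_sub sylR).
Qed.

Hypotheses (Gp1 : 'O_p(G) = 1) (p'iGN : ~~ (p %| #|G : N|)).

Lemma Sylow_sub_normal S : p.-Sylow(G) S -> S \subset N.
Proof.
case/and3P=> sSG pS _; have [_ nNG] := andP nsNG.
rewrite -quotient_sub1 ?(subset_trans sSG) // subG1 trivg_card1; apply/eqP.
apply: (pnat_1 (quotient_pgroup N pS)).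
rewrite p'natE //; apply: contra p'iGN; rewrite -card_quotient //.
by move/dvdn_trans; apply; rewrite cardSg ?quotientS.
Qed.

(** By Frattini ['N_G(S)] supplements [N], so it normalizes a Sylow subgroup [T] with nilpotent
    normalizer; then [S] lies in [T], hence equals it. *)
Lemma norm_Sylow_nilpotent S :
  S :!=: 1 -> p.-Sylow(G) S -> nilpotent 'N_G(S).
Proof.
move=> ntS sylS; have [sSG pS _] := and3P sylS.
have sylSN := pHall_subl (Sylow_sub_normal sylS) (normal_sub nsNG) sylS.
have prH := pgroup_norm_proper Gp1 sSG pS ntS.
have sSH : S \subset 'N_G(S) by rewrite subsetI sSG normG.
have pH : p %| #|'N_G(S)|.
  by apply: dvdn_trans (cardSg sSH); have [] := pgroup_pdiv pS ntS.
have [T [sylT sHT nilT _]] := supplement_sub_norm_Sylow Gp1 p_pr nilmax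
  prH pH (Frattini_arg nsNG sylSN).
have [sTG pT _] := and3P sylT.
have sylTN : p.-Sylow('N_G(T)) T.
  by rewrite (pHall_subl _ _ sylT) ?subsetIl // subsetI sTG normG.
have sST : S \subset T.
  rewrite (sub_normal_Hall sylTN) ?normalSG //.
  by rewrite subsetI sSG (subset_trans sSH).
suff -> : S :=: T by [].
by apply/eqP; rewrite eqEcard sST (card_Hall sylS) (card_Hall sylT) /=.
Qed.

Lemma norm_Sylow_dprod S :
  S :!=: 1 -> p.-Sylow(G) S -> S \x 'O_p^'('N_G(S)) = 'N_G(S).
Proof.
move=> ntS sylS; have nilNS := norm_Sylow_nilpotent ntS sylS.
have sylSN : p.-Sylow('N_G(S)) S.
  by rewrite (pHall_subl _ _ sylS) ?subsetIl // subsetI (pHall_sub sylS) normG.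
by rewrite {1}(nilpotent_Hall_pcore nilNS sylSN) nilpotent_pcoreC.
Qed.

Lemma norm_pgroup_sub_norm_Sylow Q :
    Q \subset G -> p.-group Q -> Q :!=: 1 ->
  exists2 S : {group gT}, p.-Sylow(G) S & 'N_G(Q) \subset 'N(S).
Proof.
move=> sQG pQ ntQ; have [T sylT sQT] := Sylow_superset sQG pQ.
have ntT : T :!=: 1 by apply: contraNneq ntQ => T1; rewrite -subG1 -T1.
have sTN := Sylow_sub_normal sylT.
have sylTN := pHall_subl sTN (normal_sub nsNG) sylT.
have [_ defNT cTK _] := dprodP (norm_Sylow_dprod ntT sylT).
have sKG : 'O_p^'('N_G(T)) \subset G.
  by rewrite (subset_trans (pcore_sub _ _)) ?subsetIl.
have sKQ : 'O_p^'('N_G(T)) \subset 'N_G(Q).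
  by rewrite subsetI sKG cents_norm // (subset_trans cTK) ?centS.
have defG : N * 'N_G(Q) = G.
  apply/eqP; rewrite eqEsubset mul_subG ?subsetIl ?(normal_sub nsNG) //=.
  rewrite -{1}(Frattini_arg nsNG sylTN) -defNT mulgA (mulGSid sTN).
  exact: mulgS.
have pH : p %| #|'N_G(Q)|.
  have sQN : Q \subset 'N_G(Q) by rewrite subsetI sQG normG.
  by apply: dvdn_trans (cardSg sQN); have [] := pgroup_pdiv pQ ntQ.
have prH := pgroup_norm_proper Gp1 sQG pQ ntQ.
have [S [sylS sHS _ _]] :=
  supplement_sub_norm_Sylow Gp1 p_pr nilmax prH pH defG.
by exists S.
Qed.

(** For [x != 1] the intersection of [S] and [S :^ g] contains [x ^ g], so [g] normalizes [S]. Write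
    [g = k * h] with [k] centralizing [S] and [h] in [S]. *)
Lemma Sylow_fusion S x g :
    p.-Sylow(G) S -> x \in S -> g \in G -> x ^ g \in S ->
  exists2 h, h \in S & x ^ g = x ^ h.
Proof.
move=> sylS Sx Gg Sxg.
have [-> | ntx] := eqVneq x 1; first by exists 1; rewrite ?conj1g.
have ntS : S :!=: 1 by apply: contraNneq ntx => S1; rewrite S1 inE in Sx.
have nSg : S :=: S :^ g.
  apply: (@Sylow_TI _ p _ norm_pgroup_sub_norm_Sylow <[x ^ g]>%G _ (S :^ g)%G).
  - by rewrite cycle_eq1 conjg_eq1.
  - exact: sylS.
  - by rewrite pHallJ.
  - by rewrite cycle_subG.
  - by rewrite cycle_subG memJ_conjg.
have [_ defNS cSK _] := dprodP (norm_Sylow_dprod ntS sylS).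
have : g \in 'N_G(S) by rewrite inE Gg; apply/normP/esym.
rewrite -{1}defNS -(centC cSK) => /mulsgP[k h Kk Sh ->].
by exists h; rewrite // conjgM /conjg -(centsP cSK k Kk x Sx) mulKg.
Qed.

End NormalSubgroup.

(** * Quotients and the minimal counterexample *)

Lemma quotient_maximal_nilpotent_normal_p' (gT : finGroupType) (p : nat)
    (G K : {group gT}) :
    prime p -> p %| #|G| -> K <| G -> G / K != 1 ->
    (forall M : {group gT}, maximal M G ->
       [|| nilpotent M, M <| G | ~~ (p %| #|M|)]) ->
  exists q, [/\ prime q, q %| #|G / K| &
    forall M : {group coset_of K}, maximal M (G / K) ->
       [|| nilpotent M, M <| (G / K) | ~~ (q %| #|M|)]].
Proof.
move=> p_pr pG nsKG ntGK maxG; have [sKG nKG] := andP nsKG.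
have maxGK (Mb : {group coset_of K}) : maximal Mb (G / K) ->
    [|| nilpotent Mb, Mb <| G / K | ~~ (p %| #|coset K @*^-1 Mb|)].
  rewrite -cosetpre_maximal quotientGK // => /maxG/or3P[nilM | nM | ->].
  - by rewrite -{1}(cosetpreK Mb) quotient_nil.
  - by rewrite -cosetpre_normal quotientGK // nM orbT.
  - by rewrite !orbT.
have [pGK | p'GK] := boolP (p %| #|G / K|).
  exists p; split=> // Mb /maxGK/or3P[-> | -> | p'M] //; rewrite ?orbT //.
  apply/or3P/Or33; apply: contra p'M => /dvdn_trans-> //.
  by rewrite -{1}[Mb : {set _}]cosetpreK dvdn_morphim.
(* Otherwise p divides |K|, hence the order of the preimage of every Mb, so
   that any prime divisor of |G / K| will do. *)
exists (pdiv #|G / K|); rewrite pdiv_prime ?cardG_gt1 // pdiv_dvd; split=> //.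
move=> Mb /maxGK/or3P[-> | -> | /negP[]]; rewrite ?orbT //.
have sKM : K \subset coset K @*^-1 Mb by apply: sub_cosetpre.
apply: dvdn_trans (cardSg sKM).
rewrite -(Lagrange sKG) Euclid_dvdM // -card_quotient // in pG.
by rewrite (negPf p'GK) orbF in pG.
Qed.

Unset Implicit Arguments.
Set Strict Implicit.

Theorem theorem1p3 (gT : finGroupType) (G : {group gT}) (p : nat) :
  prime p -> (p %| #|G|)%N ->
  (forall M : {group gT}, maximal M G ->
     [|| nilpotent M, M <| G | ~~ (p %| #|M|)%N]) ->
  solvable G.
Proof.
(* The prime varies in the induction, since [p] may not divide the order of a quotient. *)
have [n] := ubnP #|G|; elim: n gT G p => // n IHn gT G p leGn p_pr pG maxG.
apply/idPn => nsolG.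
have solGK (K : {group gT}) : K <| G -> K :!=: 1 -> solvable (G / K).
  move=> nsKG ntK; have [-> | ntGK] := eqVneq (G / K) 1; first exact: solvable1.
  have [q [q_pr qGK maxGK]] :=
    quotient_maximal_nilpotent_normal_p' p_pr pG nsKG ntGK maxG.
  apply: (IHn _ (G / K)%G q) => //.
  by rewrite -ltnS (leq_ltn_trans _ leGn) // ltn_quotient // normal_sub.
have Gr1 (r : nat) : 'O_r(G) = 1.
  apply/eqP/idPn => ntO; case/negP: nsolG.
  rewrite (series_sol (pcore_normal r G)) solGK ?pcore_normal // andbT.
  exact: pgroup_sol (pcore_pgroup r G).
have ntG : G :!=: 1 by apply: contraNneq nsolG => ->; apply: solvable1.
have [N minN sNG] := minnormal_exists ntG (normG G).
have [/andP[ntN nNG] Nmin] := mingroupP minN.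
have nsNG : N <| G by rewrite /normal sNG.
(* Otherwise [N :&: K = 1] by minimality, so [N] embeds in the solvable group [G / K], and [G] is
   solvable because [G / N] is. *)
have subN (K : {group gT}) : K <| G -> K :!=: 1 -> N \subset K.
  move=> nsKG ntK; have [sKG nKG] := andP nsKG.
  have [NK1 | ntNK] := eqVneq (N :&: K) 1; last first.
    by rewrite -(Nmin (N :&: K)%G) ?subsetIl ?subsetIr // ntNK normsI.
  case/negP: nsolG; rewrite (series_sol nsNG) solGK // andbT.
  have /quotient_isog : N \subset 'N(K) := subset_trans (normal_sub nsNG) nKG.
  rewrite setIC NK1 => /(_ erefl)/isog_sol ->.
  by rewrite (solvableS _ (solGK K nsKG ntK)) // quotientS // normal_sub.
have nilmax (M : {group gT}) :
    maximal M G -> p %| #|M| -> ~~ (N \subset M) -> nilpotent M.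
  move=> maxM pM; apply: contraR => nilM; have := maxG M maxM.
  (* A normal [M] is nontrivial, as [p] divides its order, so it would contain [N]. *)
  rewrite (negPf nilM) pM orbF /= => /subN-> //.
  by apply: contraTneq pM => ->; rewrite cards1 dvdn1 gtn_eqF ?prime_gt1.
have [piGN | p'iGN] := boolP (p %| #|G : N|).
  by case/eqP: ntN; apply: (dvdn_index_nilpotent_maximal p_pr nsNG nilmax Gr1).
have [S sylS] := Sylow_exists p G.
have ntG' : G^`(1) != 1.
  by apply: contra nsolG => /eqP G'1; apply/abelian_sol/derG1P.
have sSG' : S \subset G^`(1).
  apply: subset_trans (Sylow_sub_normal p_pr nsNG p'iGN sylS) _.
  by rewrite subN ?der_normal.
have ntS : S :!=: 1.
  by rewrite -cardG_gt1 (card_Hall sylS) p_part_gt1 mem_primes p_pr cardG_gt0.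
have := der1_setI_Sylow sylS
  (fun x g => Sylow_fusion p_pr nsNG nilmax (Gr1 p) p'iGN sylS).
rewrite (setIidPl sSG') => sSS'.
have := sol_der1_proper (pgroup_sol (pHall_pgroup sylS)) (subxx S) ntS.
by rewrite properE sSS' andbF.
Qed.
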